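(* Let $n,m,N,s_0,\dots,s_{n-1}$ be positive integers with $m\le N$, put $s=s_0s_1\cdots s_{n-1}$, and assume $m\mid s$. Let $\mathbb{F}$ be a finite field with $|\mathbb{F}|\ge N$ containing a primitive $s_k$-th root of unity $\omega_{s_k}$ for each $k\in\{0,\dots,n-1\}$. Consider the $n$-dimensional distributed Fourier transform problem of computing $T=\mathcal{F}\{t\}$, for input tensors $t\in\mathbb{F}^{s_0\times\cdots\times s_{n-1}}$, using $N$ workers that can each store and process a $\frac1m$ fraction of the input. Then the recovery threshold $K^*=m$ is optimal: the minimum of the recovery thresholds over all computation strategies equals $m$.
   Context: $n$-dimensional discrete Fourier transform: for a tensor $t=(t_{j_0\dots j_{n-1}})$ with entries in $\mathbb{F}$ and indices $j_\ell\in\{0,\dots,s_\ell-1\}$, the tensor $T=\mathcal{F}\{t\}$ of the same dimensions is defined by $$T_{i_0i_1\dots i_{n-1}}=\sum_{\substack{j_\ell\in\{0,\dots,s_\ell-1\}\\ \forall \ell\in\{0,\dots,n-1\}}}t_{j_0j_1\dots j_{n-1}}\prod_{k=0}^{n-1}\omega_{s_k}^{i_kj_k}.$$ Computation strategy: a tuple of $N$ encoding functions $f_0,\dots,f_{N-1}$ and $N$ computing functions $g_0,\dots,g_{N-1}$, where $f_i:\mathbb{F}^{s_0\times\cdots\times s_{n-1}}\to\mathbb{F}^{s/m}$ and $g_i:\mathbb{F}^{s/m}\to\mathbb{F}^{s/m}$ are arbitrary functions. On input $t$, worker $i$ stores $a_i=f_i(t)\in\mathbb{F}^{s/m}$, computes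 $b_i=g_i(a_i)\in\mathbb{F}^{s/m}$, and returns $b_i$ to the master. Recoverability: for an integer $k\in\{0,\dots,N\}$, a computation strategy is $k$-recoverable if for every set $S\subseteq\{0,\dots,N-1\}$ with $|S|=k$ there is a decoding function $d_S$ such that $d_S\big((b_i)_{i\in S}\big)=\mathcal{F}\{t\}$ for all inputs $t$. The recovery threshold of a computation strategy is the minimum $k$ for which it is $k$-recoverable (a strategy that is not $k$-recoverable for any $k\in\{0,\dots,N\}$ has no recovery threshold and is disregarded in the minimum). *)

(* Defs.v *)
From HB Require Import structures.
From mathcomp Require Import all_boot all_order all_algebra.

Set Implicit Arguments.
Unset Strict Implicit.
Unset Printing Implicit Defensive.

Import GRing.Theory.
Local Open Scope ring_scope.

Definition multi_index (n : nat) (s : 'I_n -> nat) : finType :=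
  {dffun forall l : 'I_n, 'I_(s l)}.

Definition tensor (F : Type) (n : nat) (s : 'I_n -> nat) : Type :=
  {ffun multi_index s -> F}.

Definition tensor_size (n : nat) (s : 'I_n -> nat) : nat :=
  (\prod_(l < n) s l)%N.

(* [omega r] is the chosen primitive r-th root of unity; only the values at
   the orders [s l] matter, and equal dimensions share the same root. *)
Definition dft (F : fieldType) (omega : nat -> F) (n : nat) (s : 'I_n -> nat)
    (t : tensor F s) : tensor F s :=
  [ffun i : multi_index s =>
     \sum_(j : multi_index s)
        t j * \prod_(k < n) omega (s k) ^+ (i k * j k)%N].

Definition worker_vector (F : Type) (n : nat) (s : 'I_n -> nat) (m : nat) :
    Type := 'rV[F]_(tensor_size s %/ m).

Record strategy (F : Type) (n : nat) (s : 'I_n -> nat) (m N : nat) : Type :=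
  Strategy {
    encode : 'I_N -> tensor F s -> worker_vector F s m;
    compute : 'I_N -> worker_vector F s m -> worker_vector F s m
  }.

Definition worker_result (F : Type) (n : nat) (s : 'I_n -> nat) (m N : nat)
    (st : strategy F s m N) (t : tensor F s) (i : 'I_N) : worker_vector F s m :=
  compute st i (encode st i t).

(* The decoder for A sees only the results of the workers in A, labelled by
   worker. *)
Definition recoverable (F : fieldType) (omega : nat -> F) (n : nat)
    (s : 'I_n -> nat) (m N : nat) (st : strategy F s m N) (k : nat) : Prop :=
  forall A : {set 'I_N}, #|A| = k ->
    exists d : {ffun {i : 'I_N | i \in A} -> worker_vector F s m} -> tensor F s,
      forall t : tensor F s,
        d [ffun i : {i : 'I_N | i \in A} => worker_result st t (val i)]
        = dft omega t.

Definition is_minimum (P : nat -> Prop) (k : nat) : Prop :=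
  P k /\ forall j : nat, P j -> (k <= j)%N.

(* The bound k <= N is essential: for k > N there is no set of k workers and
   [recoverable] holds vacuously. A strategy recoverable for no k <= N has no
   recovery threshold. *)
Definition recovery_threshold (F : fieldType) (omega : nat -> F) (n : nat)
    (s : 'I_n -> nat) (m N : nat) (st : strategy F s m N) (K : nat) : Prop :=
  is_minimum (fun k => (k <= N)%N /\ recoverable omega st k) K.

(* Main.v *)
Require Import Defs.
From mathcomp Require Import all_boot all_order all_algebra.

(** Upper bound: cut the input into m blocks of size s/m and let worker i store
    the value at the i-th element of F of the polynomial of degree < m having
    these blocks as coefficients. Any m workers determine the polynomial, hence
    the input, hence its transform; the workers need not compute anything.
    Lower bound: the Fourier transform is injective, so the results of k workers
    take at least |F|^s values, whence k * (s/m) >= s. *)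

Import GRing.Theory.
Local Open Scope ring_scope.

(** Tagging each value with its index puts all the [T i] into one type, where distributivity for
    plain functions applies; the resulting families are then transported back to dependent
    functions. *)
Lemma bigA_distr_dffun (R : comPzSemiRingType) (I : finType) (T : I -> finType)
    (P : forall i, T i -> R) :
  \prod_i \sum_(j : T i) P i j
    = \sum_(f : {dffun forall i, T i}) \prod_i P i (f i).
Proof.
under eq_bigr => i _ do rewrite (big_tag P i).
rewrite (bigA_distr_big_dep (fun i => tagged_with T i)
           (fun i j => untag 0 (P i) j)).
rewrite (reindex (@dffun_of_fprod I T)); last exact/onW_bij/dffun_of_fprod_bij.
pose Q i := [ffun j => P i j].
transitivity (\sum_(t : fprod T) \prod_(i in I) Q i (t i)); last first.
  by apply: eq_bigr => t _; apply: eq_bigr => i _; rewrite !ffunE.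
rewrite (big_fprod 1 _ Q); apply: eq_bigr => g _; apply: eq_bigr => i _.
by rewrite /untag; case: eqP => // e; rewrite ffunE.
Qed.

Lemma card_multi_index (n : nat) (s : 'I_n -> nat) :
  #|{: multi_index s}| = tensor_size s.
Proof.
have := bij_eq_card (@fprod_of_dffun_bij _ (fun l : 'I_n => 'I_(s l))).
by rewrite card_fprod => ->; apply: eq_bigr => l _; rewrite card_ord.
Qed.

(** This is a geometric sum of ratio [z = w ^+ j / w ^+ l]. Since [z ^+ r = 1], multiplying it by
    [z - 1] gives 0, and [z != 1] unless [j = l], both exponents being below [r]. *)
Lemma prim_root_orthogonality {F : fieldType} {r : nat} {w : F}
    (w_prim : r.-primitive_root w) (j l : 'I_r) :
  \sum_(i < r) w ^+ (i * j) / w ^+ (i * l) = r%:R *+ (j == l).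
Proof.
have w_neq0 : w != 0.
  by rewrite (prim_root_eq0 w_prim) -lt0n (prim_order_gt0 w_prim).
pose z := w ^+ j / w ^+ l.
under eq_bigr => i _ do rewrite 2![(i * _)%N]mulnC !exprM -expr_div_n.
have [-> | j_neq_l] := eqVneq j l.
  under eq_bigr => i _ do rewrite divff ?expf_neq0 // expr1n.
  by rewrite sumr_const card_ord.
have z_neq1 : z - 1 != 0.
  rewrite subr_eq0 /z -(inj_eq (mulIf (expf_neq0 l w_neq0))) mul1r.
  by rewrite divfK ?expf_neq0 // (eq_prim_root_expr w_prim) !modn_small.
apply: (mulfI z_neq1); rewrite -subrX1 /z expr_div_n -!exprM ![(_ * r)%N]mulnC.
by rewrite !exprM (prim_expr_order w_prim) !expr1n divr1 subrr mulr0.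
Qed.

Section Dft.

Variables (F : fieldType) (omega : nat -> F) (n : nat) (s : 'I_n -> nat).
Hypothesis omega_prim : forall k, (s k).-primitive_root (omega (s k)).

(** The sum factors into one-dimensional sums, one per coordinate; a single coordinate where [j] and
    [l] differ kills the product. *)
Lemma dft_orthogonality (j l : multi_index s) :
  \sum_(i : multi_index s) (\prod_k omega (s k) ^+ (i k * j k)%N)
      / (\prod_k omega (s k) ^+ (i k * l k)%N)
    = (tensor_size s)%:R *+ (j == l).
Proof.
under eq_bigr => i _ do rewrite -prodf_div.
rewrite -(bigA_distr_dffun _ _ (fun k : 'I_n => 'I_(s k))
  (fun k (x : 'I_(s k)) =>
     omega (s k) ^+ (x * j k) / omega (s k) ^+ (x * l k))).
under eq_bigr => k _ do rewrite (prim_root_orthogonality (omega_prim k)).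
have [-> | /eqP j_neq_l] := eqVneq j l.
  by rewrite natr_prod; apply: eq_bigr => k _; rewrite eqxx.
have [k jk_neq_lk] : exists k, j k != l k.
  apply/existsP; apply: contra_notT j_neq_l; rewrite negb_exists.
  by move=> /forallP eq_jl; apply/ffunP => k; apply/eqP/negbNE.
by rewrite (bigD1 k) //= (negPf jk_neq_lk) mul0r.
Qed.

Lemma dft_inversion (t : tensor F s) (l : multi_index s) :
  \sum_i dft omega t i / \prod_k omega (s k) ^+ (i k * l k)%N
    = t l * (tensor_size s)%:R.
Proof.
under eq_bigr => i _ do rewrite ffunE big_distrl /=.
rewrite exchange_big /=.
under eq_bigr => j _.
  under eq_bigr => i _ do rewrite -mulrA.
  rewrite -big_distrr dft_orthogonality /=.
  over.
rewrite (bigD1 l) //= eqxx big1 ?addr0 // => j /negPf ->.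
by rewrite mulr0.
Qed.

Lemma dft_inj : injective (@dft F omega n s).
Proof.
move=> t u eq_tu; apply/ffunP => l.
(* A primitive root of order [s k] in [F] forces [s k] to be nonzero in [F], so the factor left by
   the inversion formula cancels. *)
have size_neq0 : (tensor_size s)%:R != 0 :> F.
  rewrite natr_prod; apply/prodf_neq0 => k _.
  exact: prim_root_natf_neq0 (omega_prim k).
by apply: (mulIf size_neq0); rewrite -!dft_inversion eq_tu.
Qed.

End Dft.

(** The difference of the two polynomials has size at most [m] and at least [m] distinct roots, so
    it is zero. *)
Lemma rVpoly_inj_horner {F : fieldType} {m : nat} (xs : seq F)
    (u v : 'rV[F]_m) :
  uniq xs -> (m <= size xs)%N ->
  {in xs, forall x, (rVpoly u).[x] = (rVpoly v).[x]} -> u = v.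
Proof.
move=> xs_uniq le_m_xs eq_uv; apply: (can_inj rVpolyK); apply/eqP.
rewrite -subr_eq0 -raddfB; apply/eqP; apply: (roots_geq_poly_eq0 _ xs_uniq).
  apply/allP => x x_xs; apply/rootP.
  by rewrite raddfB hornerD hornerN (eq_uv x x_xs) subrr.
exact: leq_trans (size_poly _ _) le_m_xs.
Qed.

Section Workers.

Variables (F : finFieldType) (omega : nat -> F) (n m N : nat) (s : 'I_n -> nat).

Lemma recoverable_leq (st : strategy F s m N) (k : nat) :
  (0 < tensor_size s)%N -> (m %| tensor_size s)%N ->
  (forall k, (s k).-primitive_root (omega (s k))) ->
  (k <= N)%N -> recoverable omega st k -> (m <= k)%N.
Proof.
move=> size_gt0 m_dvd_s omega_prim le_kN st_rec.
have /card_geqP [r [r_uniq size_r _]] : (k <= #|'I_N|)%N by rewrite card_ord.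
pose A := [set i in r].
have card_A : #|A| = k by rewrite cardsE (card_uniqP r_uniq).
have [d dK] := st_rec A card_A.
pose results (t : {ffun multi_index s -> F}) :
    {ffun {i : 'I_N | i \in A} -> 'rV[F]_(tensor_size s %/ m)} :=
  [ffun i : {i : 'I_N | i \in A} => worker_result st t (val i)].
have results_inj : injective results.
  move=> t u eq_tu; apply: (dft_inj _ _ _ _ omega_prim).
  by rewrite -!dK -/(results _) eq_tu.
have := leq_card _ results_inj.
(* Comparing exponents of [#|F|] gives [tensor_size s <= (tensor_size s %/ m) * k]; the positive
   block length then cancels. *)
rewrite !card_ffun card_multi_index card_mx mul1n card_sig card_A.
rewrite -expnM leq_exp2l ?card_finNzRing_gt1 // -{1}(divnK m_dvd_s).
rewrite leq_pmul2l //.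
by rewrite divn_gt0 ?(dvdn_leq size_gt0 m_dvd_s) ?(dvdn_gt0 size_gt0 m_dvd_s).
Qed.

Section PolynomialCode.

Variables (blocks : tensor F s -> 'M[F]_(m, tensor_size s %/ m)).
Variables (point : 'I_N -> F).

(** A Reed-Solomon code applied to each column of the block matrix separately. *)
Definition poly_code : strategy F s m N :=
  Strategy
    (fun i t => \row_c (rVpoly (row c (blocks t)^T)).[point i])
    (fun _ => id).

Lemma poly_code_recoverable :
  injective blocks -> injective point -> recoverable omega poly_code m.
Proof.
move=> blocks_inj point_inj A card_A.
pose results (t : {ffun multi_index s -> F}) :
    {ffun {i : 'I_N | i \in A} -> 'rV[F]_(tensor_size s %/ m)} :=
  [ffun i : {i : 'I_N | i \in A} => worker_result poly_code t (val i)].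
have results_inj : injective results.
  move=> t u eq_tu; apply: blocks_inj; apply: trmx_inj; apply/row_matrixP => c.
  apply: (@rVpoly_inj_horner F m [seq point i | i <- enum A]).
  - by rewrite map_inj_uniq ?enum_uniq.
  - by rewrite size_map -cardE card_A.
  move=> x /mapP [i]; rewrite mem_enum => i_A ->.
  have /ffunP /(_ (exist _ i i_A)) /[!ffunE] /rowP /(_ c) := eq_tu.
  by rewrite /worker_result /= !mxE.
(* The decoder searches for an input with the given results. The default 0 is never reached on
   actual results, since [t] itself is a match. *)
exists (fun r => dft omega (odflt 0 [pick t | results t == r])) => t.
rewrite -/(results t); case: pickP => [u /eqP /results_inj -> // |].
by move=> /(_ t); rewrite eqxx.
Qed.

End PolynomialCode.

End Workers.

Theorem theorem4 (n m N : nat) (s : 'I_n -> nat) (F : finFieldType)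
    (omega : nat -> F)
    (n_gt0 : (0 < n)%N) (m_gt0 : (0 < m)%N) (N_gt0 : (0 < N)%N)
    (s_gt0 : forall k : 'I_n, (0 < s k)%N)
    (le_mN : (m <= N)%N)
    (m_dvd_s : (m %| tensor_size s)%N)
    (card_F : (N <= #|F|)%N)
    (omega_prim : forall k : 'I_n, ((s k).-primitive_root (omega (s k)))%R) :
  is_minimum
    (fun K : nat => exists st : strategy F s m N, recovery_threshold omega st K)
    m.
Proof.
have size_gt0 : (0 < tensor_size s)%N by apply: prodn_gt0.
split=> [|K [st [[le_KN st_rec] _]]]; last exact: recoverable_leq st_rec.
have card_blocks :
    #|{ffun multi_index s -> F}| = #|{: 'M[F]_(m, tensor_size s %/ m)}|.
  by rewrite card_ffun card_multi_index card_mx mulnC divnK.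
(* Only injectivity of the cutting matters, so a bijection between two finite types of equal
   cardinality serves. *)
pose blocks (t : tensor F s) : 'M[F]_(m, tensor_size s %/ m) :=
  enum_val (cast_ord card_blocks (enum_rank (t : {ffun multi_index s -> F}))).
have blocks_inj : injective blocks.
  by move=> t u /enum_val_inj /cast_ord_inj /enum_rank_inj.
(* The bound [N <= #|F|] provides distinct evaluation points for all workers. *)
pose point (i : 'I_N) : F := enum_val (widen_ord card_F i).
have point_inj : injective point.
  by move=> i j /enum_val_inj /(congr1 val) /= /val_inj.
exists (poly_code _ _ _ _ _ blocks point); split.
  by split=> //; apply: poly_code_recoverable.
by move=> k [le_kN st_rec]; apply: recoverable_leq st_rec.
Qed.
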